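(* For all integers $n\ge 3$ and $1\le k\le n-1$, \[ \mathbb{P}(K_n>k)=\frac{(n-k)!}{(n-1)!}\sum_{r=1}^{\min\{k,\lfloor (n-k)/2\rfloor\}}2^{k-r}\,(r-1)!\,S(k,r)\binom{n-k-r-1}{r-1}, \] where $S(k,r)$ is the Stirling number of the second kind (the number of partitions of a $k$-element set into $r$ nonempty blocks), and an empty sum is $0$. Hence \[ \mathbb{P}(K_n=k)=\mathbb{P}(K_n>k-1)-\mathbb{P}(K_n>k). \]
   Context: Let $n\ge 3$ and let $C_n$ be the cycle graph on vertex set $\mathbb{Z}/n\mathbb{Z}$ ($v$ is adjacent to $v-1$ and $v+1$). Let $\pi=(\pi_1,\dots,\pi_n)$ be a uniformly random permutation (ordering) of the vertices, and $A_t=\{\pi_1,\dots,\pi_t\}$ for $0\le t\le n$. A vertex $v\in A_t$ is isolated at time $t$ if neither neighbor of $v$ lies in $A_t$. Define $\tau_n=\max\{t: \text{the induced subgraph } C_n[A_t]\text{ contains an isolated vertex}\}$ and $K_n=n-\tau_n$. *)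

(* Defs.v *)
From mathcomp Require Import all_boot all_order all_algebra all_fingroup.
Set Implicit Arguments.
Unset Strict Implicit.
Unset Printing Implicit Defensive.
Import GRing.Theory Num.Theory.
Local Open Scope ring_scope.

(* The vertex type 'Z_n is Z/nZ only for n >= 2; these definitions are meant
   to be used with n >= 3. *)
Definition cycle_adj (n : nat) : rel 'Z_n :=
  fun v w => (w == v - 1) || (w == v + 1).

(* pi lists the vertices as pi 0, ..., pi (n - 1): positions are 0-based, so
   the first t vertices are those at the positions i < t. *)
Definition prefix_set (n : nat) (pi : {perm 'Z_n}) (t : nat) : {set 'Z_n} :=
  [set pi i | i : 'Z_n & (i < t)%N].

Definition isolated (n : nat) (A : {set 'Z_n}) (v : 'Z_n) : bool :=
  (v \in A) && [forall w, cycle_adj v w ==> (w \notin A)].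

Definition has_isolated (n : nat) (A : {set 'Z_n}) : bool :=
  [exists v, isolated A v].

(* For n >= 3 the maximum is over a nonempty set, since t = 1 qualifies. *)
Definition tau (n : nat) (pi : {perm 'Z_n}) : nat :=
  (\max_(t < n.+1 | has_isolated (prefix_set pi t)) t)%N.

Definition K (n : nat) (pi : {perm 'Z_n}) : nat := (n - tau pi)%N.

(* Probability of E under the uniform distribution on T. *)
Definition Pr (T : finType) (E : pred T) : rat := #|E|%:R / #|T|%:R.

Definition stirling2 (k r : nat) : nat :=
  #|[set P : {set {set 'I_k}} | partition P [set: 'I_k] & #|P| == r]|.

(* Main.v *)
Require Import Defs.
From mathcomp Require Import all_boot all_order all_algebra all_fingroup.
From mathcomp Require Import ring zify.
Set Implicit Arguments.
Unset Strict Implicit.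
Unset Printing Implicit Defensive.
Import GRing.Theory Num.Theory.

(** Read the ordering backwards: the vertices of the cycle are removed one at a
    time, and [k < K pi] says that no survivor is isolated after j removals, for
    every j from 0 to k.  An isolated survivor is a gap of length one between
    removed vertices.  A gap of length two or more would have to pass through
    length one before being filled, so in an admissible history the removed
    arcs never merge: a removal either lengthens an arc by one vertex or starts
    a new arc inside a gap.

    Take the first removed vertex as origin, go around the cycle, and record for
    each survivor whether the position just before it is removed; one last
    letter [true] stands for the return to the origin.  This cut word forgets
    the lengths of the arcs and keeps the lengths of the gaps: r gaps give r + 1
    letters [true], and no survivor is isolated exactly when no two consecutive
    letters are [true].  Removing a survivor replaces the letters on both of its
    sides by a single [true] ([map_cuts_removals]), so one can count histories
    by undoing the last removal, that is by splitting a [true] of the word into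
    two letters ([historiesS]).  An interior [true] comes from 01, 10 or 00; a
    word begins and ends with [true], so the first letter comes from 10 only and
    the last one from 01 only.  A word with r gaps thus has 2r predecessors with
    r gaps and r - 1 with r - 1 gaps ([sum_splits_proper]).  The number of
    histories of length k with a given origin and a given cut word therefore
    depends only on k and on the number r of gaps, and satisfies

      c (k + 1) r = 2 r * c k r + (r - 1) * c k (r - 1).

    The recurrence of the Stirling numbers ([stirling2S]) shows that
    2 ^ (k - r) (r - 1)! S(k, r) is its solution ([weightS], [histories_proper]).
    It remains to multiply by the number of admissible words with r gaps, a
    binomial coefficient ([card_spaced_true]), and by the (n - k)! orderings of
    the vertices that are still present after k removals ([card_uniq_drop]). *)

(** * Counting tuples *)

Lemma card_cons_tuple (T : finType) m (P : pred (seq T)) :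
  #|[pred t : m.+1.-tuple T | P t]| =
  \sum_(s : m.-tuple T) #|[pred x | P (x :: s)]|.
Proof.
transitivity (\sum_(s : m.-tuple T) \sum_(x | P (x :: s)) 1).
  rewrite pair_big_dep /= -sum1_card.
  rewrite (reindex (fun p : m.-tuple T * T => [tuple of p.2 :: p.1])) //=.
  exists (fun t : m.+1.-tuple T => ([tuple of behead t], thead t)).
    by move=> [s x] _ /=; congr (_, _); apply: val_inj.
  by move=> t _; rewrite [t in RHS]tuple_eta.
by apply: eq_bigr => s _; rewrite sum1_card; apply: eq_card.
Qed.

(** A duplicate-free tuple is extended at its head: the last [k] entries carry
    the constraint and the others are then chosen freely. *)
Lemma card_uniq_drop (T : finType) N k d (Q : pred (seq T)) : N = d + k ->
  #|[pred u : N.-tuple T | uniq u && Q (drop d u)]| =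
  (#|T| - k) ^_ d * #|[pred u : k.-tuple T | uniq u && Q u]|.
Proof.
move=> ->; elim: d => [|d IHd].
  by rewrite ffactn0 mul1n; apply: eq_card => u; rewrite !inE drop0.
rewrite (@card_cons_tuple _ (d + k) (fun u => uniq u && Q (drop d.+1 u))).
rewrite ffactnSr mulnAC -IHd -sum1_card big_distrl /= [RHS]big_mkcond /=.
apply: eq_bigr => u _; rewrite inE /=.
case: (boolP (uniq u)) => [Uu | _]; last first.
  by rewrite /= -(card0 T); apply: eq_card => x; rewrite !inE andbF.
case: (boolP (Q _)) => [Qu | _]; last first.
  by rewrite /= -(card0 T); apply: eq_card => x; rewrite !inE andbF.
rewrite /= mul1n -subnDA [k + d]addnC -{2}(size_tuple u) -(card_uniqP Uu).
rewrite -(cardC (mem u)) addKn.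
by apply: eq_card => x; rewrite !inE !andbT.
Qed.

(** * Cut words *)

(** [w] tells which positions are removed, [true] meaning removed, and [b] is the
    status of the position before [w].  Each survivor contributes the status of
    the position before it.  The final [true] is the position after [w], which
    is removed as well: on the cycle it is the origin again. *)
Fixpoint cuts (b : bool) (w : seq bool) : seq bool :=
  match w with
  | [::] => [:: true]
  | true :: w' => cuts true w'
  | false :: w' => b :: cuts false w'
  end.

Definition not_both (a b : bool) := ~~ (a && b).

Fixpoint removals (w : seq bool) : seq (seq bool) :=
  match w with
  | [::] => [::]
  | true :: w' => [seq true :: u | u <- removals w']
  | false :: w' => (true :: w') :: [seq false :: u | u <- removals w']
  end.

(** Merging two adjacent letters into [true], at each place in turn: the effect of
    a removal on a cut word. *)
Fixpoint merges (e : seq bool) : seq (seq bool) :=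
  if e is a :: e1 then
    if e1 is _ :: e2 then (true :: e2) :: [seq a :: u | u <- merges e1]
    else [::]
  else [::].

(** The converse of [merges]: every way of splitting one letter [true] in two. *)
Fixpoint splits (e : seq bool) : seq (seq bool) :=
  if e is a :: e1 then
    (if a then [:: [:: true, true & e1]; [:: true, false & e1];
                   [:: false, true & e1]; [:: false, false & e1]]
     else [::]) ++ [seq a :: u | u <- splits e1]
  else [::].

Lemma cuts_cons b w :
  cuts b w = (b || nth true w 0) :: behead (cuts false w).
Proof.
elim: w b => [|[] w IHw] b /=; rewrite ?orbT ?orbF //.
by rewrite [LHS]IHw [in RHS]IHw.
Qed.

Lemma size_cuts b w : size (cuts b w) = (count negb w).+1.
Proof. by elim: w b => [|[] w IHw] b //=; rewrite IHw. Qed.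

Lemma last_cuts b c w : last c (cuts b w) = true.
Proof. by elim: w b c => [|[] w IHw] b c //=. Qed.

(** The two letters around a survivor are its own and that of the next survivor.
    Once it is removed, the next survivor has a removed position before it, and
    the other letters do not change. *)
Lemma map_cuts_removals b w : map (cuts b) (removals w) = merges (cuts b w).
Proof.
elim: w b => [|[] w IHw] b //=.
  by rewrite -IHw -map_comp.
rewrite (cuts_cons true); have := IHw false; rewrite (cuts_cons false).
move: (behead _) => v /= <-; by rewrite -!map_comp.
Qed.

Lemma count_cons_map (a x : bool) e (s : seq (seq bool)) :
  count_mem (x :: e) [seq a :: u | u <- s] = (a == x) * count_mem e s.
Proof.
rewrite count_map; case: eqP => [-> | /eqP/negPf nax] /=.
  by rewrite mul1n; apply: eq_count => u; rewrite /= eqseq_cons eqxx.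
by rewrite -(@eq_count _ pred0) ?count_pred0 // => u; rewrite /= eqseq_cons nax.
Qed.

Lemma count_nil_map (a : bool) (s : seq (seq bool)) :
  count_mem [::] [seq a :: u | u <- s] = 0.
Proof. by rewrite count_map -(@eq_count _ pred0) ?count_pred0. Qed.

Lemma count_merges_splits e e' : count_mem e' (merges e) = count_mem e (splits e').
Proof.
elim: e' e => [|a' e' IHe'] [|a e] //.
- by elim: e a => // b e IHe a /=; rewrite count_nil_map.
- by rewrite /= count_cat count_nil_map; case: a'.
rewrite [splits _]/= count_cat count_cons_map -IHe'.
case: e => [|b e].
  rewrite [merges _]/= muln0 addn0.
  by case: a' => //=; rewrite !eqseq_cons !andbF.
rewrite [merges (a :: _)]/=  [LHS]/= count_cons_map eq_sym; congr (_ + _).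
  rewrite eq_sym eqseq_cons; case: a' => //=.
  rewrite !eqseq_cons; rewrite [e == e']eq_sym.
  by case: a b => [] []; rewrite /= ?addn0.
by rewrite eq_sym.
Qed.

(** The tail of a cut word: [b] is the letter before [f]. *)
Definition spaced b f := path not_both b f && last b f.

Definition proper e := if e is a :: f then a && spaced a f else false.

Lemma spaced_count_gt0 b f : f != [::] -> spaced b f -> 0 < count id f.
Proof.
case: f => // a s _ /andP[_ last_f]; rewrite -has_count.
by apply/hasP; exists (last a s); first exact: mem_last.
Qed.

(** Splitting a [true] of [f] into 01 keeps the word admissible; 10 and 00 do so
    for every [true] but the last, which must stay at the end of the word; 11
    never does.  Of these only 00 lowers the number of [true] letters. *)
Lemma sum_splits_spaced b (f : seq bool) (phi : nat -> nat) :
  f != [::] -> spaced b f ->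
  \sum_(g <- splits f | spaced b g) phi (count id g) =
    (2 * (count id f).-1).+1 * phi (count id f)
    + (count id f).-1 * phi (count id f).-1.
Proof.
elim: f b phi => // a f IHf b phi _ ok_f.
rewrite [splits _]/= big_cat big_map.
have ok_a : spaced a f by case/andP: ok_f => /andP[_ ?] ?; apply/andP.
case: a ok_f ok_a => ok_f ok_a; last first.
  have f_n0 : f != [::] by apply: contraTneq ok_f => ->; rewrite /spaced /= andbF.
  rewrite /= big_nil add0n -(IHf false) //; apply: eq_bigl => g.
  by rewrite /spaced /= /not_both andbF.
(* The head letter is true, so the letter before it is not. *)
have b0 : b = false by case: b ok_f.
subst b; rewrite !big_cons big_nil.
have -> : spaced false [:: true, true & f] = false by [].
have -> : spaced false [:: false, true & f] by [].
have [-> | f_n0] := eqVneq f [::].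
  by rewrite /= big_nil /= !addn0.
have ok_0 : spaced false f by case: (f) f_n0 ok_a => //= [[]].
have -> : spaced false [:: true, false & f] by [].
have -> : spaced false [:: false, false & f] by [].
under eq_bigl do rewrite /spaced /= -/(spaced true _).
rewrite (IHf true (fun j => phi j.+1)) //.
have c_gt0 := spaced_count_gt0 f_n0 ok_0.
rewrite /= -![count (fun x => x) f]/(count id f).
by case: (count id f) c_gt0 => // j _ /=; rewrite !add0n !add1n addn0; ring.
Qed.

(** Two consecutive [true] letters belong to a survivor with a removed position
    on each side. *)
Lemma sorted_cuts b w :
  sorted not_both (cuts b w) =
  ~~ has (fun i => [&& nth true (b :: w) i, ~~ nth true w i & nth true w i.+1])
       (iota 0 (size w)).
Proof.
elim: w b => [|a w IHw] b //=.
rewrite (iotaDl 1) has_map (eq_has (a2 := fun i =>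
  [&& nth true (a :: w) i, ~~ nth true w i & nth true w i.+1])); last by [].
rewrite negb_or -IHw; case: a => /=; first by rewrite andbF.
by rewrite [cuts _ w]cuts_cons.
Qed.

Lemma mkseq_head (T : Type) (g : nat -> T) N :
  mkseq g N.+1 = g 0 :: mkseq (fun j => g j.+1) N.
Proof. by rewrite /mkseq /= (iotaDl 1 0) -map_comp. Qed.

Lemma removals_mkseq g N :
  removals (mkseq g N) =
  [seq mkseq (fun j => (j == i) || g j) N | i <- iota 0 N & ~~ g i].
Proof.
elim: N g => // N IHN g.
rewrite mkseq_head [removals _]/= IHN [iota 0 N.+1]/= (iotaDl 1 0) [filter _ _]/=.
case E: (g 0); rewrite [in RHS]/= E /= filter_map -!map_comp.
  by apply: eq_map => i; rewrite /comp mkseq_head E orbT.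
rewrite mkseq_head eqxx; congr (_ :: _).
by apply: eq_map => i; rewrite /comp mkseq_head E.
Qed.

(** The first letter is [false], or, when the letter before it is not [true],
    it is [true]. *)
Lemma card_spaced_cons b L r :
  #|[pred f : L.+1.-tuple bool | spaced b f && (count id f == r)]| =
  #|[pred f : L.-tuple bool | spaced false f && (count id f == r)]| +
  (~~ b && (0 < r)) *
    #|[pred f : L.-tuple bool | spaced true f && (count id f == r.-1)]|.
Proof.
rewrite (@card_cons_tuple _ L (fun f => spaced b f && (count id f == r))).
rewrite -!sum1_card !(big_mkcond (fun _ => _ \in _)) big_distrr -big_split /=.
apply: eq_bigr => s _; rewrite !inE -sum1_card big_mkcond /= big_bool /=.
rewrite !inE /spaced /= /not_both andbT andbF add0n addnC; congr (_ + _).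
by case: b r => [] [|r] //=; rewrite ?mul0n ?mul1n ?andbF.
Qed.

(** Pascal's rule: a word starts with [false], or with [true] followed by [false]
    (for length at least 2), hence u (L + 2) (r + 1) = u (L + 1) (r + 1) + u L r. *)
Lemma card_spaced_false L r :
  #|[pred f : L.+1.-tuple bool | spaced false f && (count id f == r.+1)]|
  = 'C(L - r, r).
Proof.
pose u L r := #|[pred f : L.-tuple bool | spaced false f && (count id f == r)]|.
have u0 j : u 0 j = 0 by apply: eq_card0 => f; rewrite !inE (tuple0 f).
have uSS i j : u i.+2 j.+1 = u i.+1 j.+1 + u i j.
  by rewrite /u card_spaced_cons /= mul1n [X in _ + X]card_spaced_cons addn0.
have un0 i : u i 0 = 0.
  by elim: i => // i IHi; rewrite /u card_spaced_cons andbF addn0.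
have u1 j : u 1 j.+1 = (j == 0).
  rewrite /u card_spaced_cons -/(u 0 j.+1) u0 mul1n add0n.
  rewrite (eq_card (B := fun f => j == 0)).
    by case: j => [|j]; [rewrite cardT -cardE card_tuple | apply: eq_card0].
  by move=> f; rewrite (tuple0 f) inE /= eq_sym.
elim/ltn_ind: L r => [[|L] IHL] r; rewrite -/(u _ _).
  by rewrite u1 sub0n bin0n; case: r.
rewrite uSS [u L.+1 _]IHL //.
case: r => [|r]; first by rewrite un0 !bin0.
case: L IHL => [|L] IHL; first by rewrite u0 sub0n /= subSS sub0n !bin0n.
rewrite [u L.+1 _]IHL // !subSS.
have [rL | Lr] := leqP r L; first by rewrite subSn // binS.
have -> : L - r = 0 by lia.
have -> : L.+1 - r = 0 by lia.
by case: r Lr {IHL}.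
Qed.

Lemma card_spaced_true L r :
  #|[pred f : L.+2.-tuple bool | spaced true f && (count id f == r.+1)]|
  = 'C(L - r, r).
Proof. by rewrite card_spaced_cons /= mul0n addn0 card_spaced_false. Qed.

Lemma card_spaced_true0 L :
  #|[pred f : L.+1.-tuple bool | spaced true f && (count id f == 0)]| = 0.
Proof.
apply: eq_card0 => f; rewrite inE; apply/negP => /andP[ok_f].
by rewrite eqn0Ngt (spaced_count_gt0 _ ok_f) // -size_eq0 size_tuple.
Qed.

Lemma sum_spaced_true Z (c : nat -> nat) :
  0 < Z ->
  \sum_(f : Z.-tuple bool | spaced true f) c (count id f) =
  \sum_(1 <= r < (Z %/ 2).+1) c r * 'C(Z - r - 1, r - 1).
Proof.
move=> Z_gt0.
rewrite (partition_big (fun f : Z.-tuple bool => inord (count id f) : 'I_Z.+1) predT) //=.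
have cZ (f : Z.-tuple bool) : (inord (count id f) : 'I_Z.+1) = count id f :> nat.
  by rewrite (@inordK Z) // ltnS -[in leqRHS](size_tuple f) count_size.
transitivity (\sum_(j < Z.+1) c j *
    #|[pred f : Z.-tuple bool | spaced true f && (count id f == j)]|).
  apply: eq_bigr => j _; rewrite -sum1_card big_distrr /=.
  apply: eq_big => [f | f /andP[_ /eqP <-]]; first by rewrite inE -val_eqE /= cZ.
  by rewrite cZ muln1.
pose F j := c j * #|[pred f : Z.-tuple bool | spaced true f && (count id f == j)]|.
rewrite -(big_mkord predT F) (@big_ltn _ _ _ 0) // {1}/F.
case: Z Z_gt0 @F {cZ} => // Z _ F; rewrite card_spaced_true0 muln0 add0n.
case: Z @F => [|Z] F.
  rewrite [RHS]big_geq // big_nat1 /F card_spaced_cons /= mul0n addn0.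
  by rewrite eq_card0 ?muln0 // => f; rewrite (tuple0 f).
rewrite (@big_cat_nat _ _ _ (Z.+2 %/ 2).+1) //=; last by lia.
rewrite [X in _ + X]big_nat_cond [X in _ + X]big1 ?addn0; last first.
  case=> [|r]; first by rewrite /F card_spaced_true0 muln0.
  case/andP=> /andP[Zr _] _; rewrite /F card_spaced_true bin_small ?muln0 //; lia.
apply: eq_big_nat => -[|r] // rZ.
by rewrite /F card_spaced_true; congr (_ * 'C(_, _)); lia.
Qed.

Lemma size_splits e e' : e' \in splits e -> size e' = (size e).+1.
Proof.
elim: e e' => // a e IHe e' /=; rewrite mem_cat => /orP[|/mapP[u /IHe sz_u ->]].
  by case: a; rewrite ?inE // => /or4P[] /eqP ->.
by rewrite /= sz_u.
Qed.

(** The initial [true] can only come from 10; together with [sum_splits_spaced]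
    for the other letters, this gives the recurrence on the number of gaps. *)
Lemma sum_splits_proper (f : seq bool) (phi : nat -> nat) :
  f != [::] -> spaced true f ->
  \sum_(e <- splits (true :: f) | proper e) phi (count id (behead e)) =
    2 * count id f * phi (count id f)
    + (count id f).-1 * phi (count id f).-1.
Proof.
move=> f_n0 ok_f; rewrite [splits _]/= !big_cons big_map.
have ok_0 : spaced false f by case: (f) f_n0 ok_f => // -[].
have -> : proper [:: true, true & f] = false by [].
have -> : proper [:: true, false & f] by [].
have -> : proper [:: false, true & f] = false by [].
have -> : proper [:: false, false & f] = false by [].
have /= -> := sum_splits_spaced phi f_n0 ok_f.
rewrite -![count (fun x => x) f]/(count id f).
by case: (count id f) (spaced_count_gt0 f_n0 ok_f) => // j _ /=; ring.
Qed.

(** * Set partitions *)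

(** Partitions of a subset of a finite type, so that an element can be added to
    the ground set without a change of type. *)
Definition set_partitions (T : finType) (D : {set T}) r : {set {set {set T}}} :=
  [set P : {set {set T}} | partition P D & #|P| == r].

Section Recurrence.

Variables (T : finType) (x : T) (D : {set T}).
Hypothesis xD : x \notin D.

(** Deleting the block consisting of [x] alone. *)
Lemma card_set_partitions_singleton r :
  #|set_partitions (x |: D) r.+1 :&: [set P : {set {set T}} | [set x] \in P]|
  = #|set_partitions D r|.
Proof.
have notin (Q : {set {set T}}) : partition Q D -> [set x] \notin Q.
  move=> parQ; apply: contra xD => /(partitionS parQ)/subsetP; apply.
  exact: set11.
rewrite -(card_in_imset (f := fun Q => [set x] |: Q)
                        (D := mem (set_partitions D r))).
  apply: eq_card => P; rewrite !inE.
  apply/andP/imsetP => [[/andP[parP /eqP cP] xP] | [Q]].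
    exists (P :\ [set x]); last by rewrite setD1K.
    rewrite inE -(setU1K xD) partitionD1 //=.
    by rewrite (cardsD1 [set x]) xP add1n in cP; case: cP => ->.
  rewrite inE => /andP[parQ /eqP cQ] ->.
  rewrite setU11 cardsU1 notin // cQ eqxx partitionU1 //.
  - by apply/set0Pn; exists x; rewrite set11.
  - by rewrite disjoints1.
move=> Q1 Q2; rewrite !inE => /andP[parQ1 _] /andP[parQ2 _] eqQ.
by rewrite -(setU1K (notin _ parQ1)) eqQ setU1K // notin.
Qed.

(** When the block of [x] has another element, removing [x] from it leaves a
    partition of [D] with as many blocks; conversely [x] can be inserted into any
    of its [r] blocks. *)
Lemma card_set_partitions_insert r :
  #|set_partitions (x |: D) r :\: [set P : {set {set T}} | [set x] \in P]| =
  r * #|set_partitions D r|.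
Proof.
pose pairs := [set QB : {set {set T}} * {set T} |
                (QB.1 \in set_partitions D r) & QB.2 \in QB.1].
pose ins (QB : {set {set T}} * {set T}) := (x |: QB.2) |: QB.1 :\ QB.2.
have xB (Q : {set {set T}}) (B : {set T}) : partition Q D -> B \in Q -> x \notin B.
  by move=> parQ BQ; apply: contra xD; apply/subsetP/(partitionS parQ).
have insP Q B : (Q, B) \in pairs -> partition (ins (Q, B)) (x |: D).
  rewrite !inE /= => /andP[/andP[parQ _] BQ]; rewrite /ins /=.
  have -> : x |: D = (x |: B) :|: (D :\: B).
    rewrite -setUA; congr (_ |: _); rewrite -[LHS](setID D B).
    by rewrite (setIidPr (partitionS parQ BQ)).
  apply: partitionU1; first exact: partitionD1.
  - by apply/set0Pn; exists x; rewrite setU11.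
  - rewrite -setI_eq0; apply/eqP/setP => y; rewrite !inE.
    by have [-> | _] := eqVneq y x; rewrite ?(negPf xD) ?andbF //; case: (y \in B).
have blk Q B : (Q, B) \in pairs -> pblock (ins (Q, B)) x = x |: B.
  move=> QB; apply: def_pblock; rewrite ?setU11 //.
  exact: partition_trivIset (insP _ _ QB).
have newB Q B : (Q, B) \in pairs -> x |: B \notin Q :\ B.
  rewrite !inE /= => /andP[/andP[parQ _] BQ]; apply/negP => /andP[_ xBQ].
  by have := xB _ _ parQ xBQ; rewrite setU11.
transitivity #|pairs|; last first.
  rewrite -sum1_card (eq_bigl (fun QB =>
    (QB.1 \in set_partitions D r) && (QB.2 \in QB.1))); last first.
    by move=> QB; rewrite inE.
  rewrite -(pair_big_dep (fun Q => Q \in set_partitions D r)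
                         (fun Q B => B \in Q) (fun _ _ => 1)) /=.
  rewrite mulnC -sum_nat_const; apply: eq_bigr => Q.
  by rewrite inE => /andP[_ /eqP <-]; rewrite sum1_card.
rewrite -(card_in_imset (f := ins) (D := mem pairs)); last first.
  move=> [Q1 B1] [Q2 B2] p1 p2 eq_ins.
  have := p1; have := p2; rewrite !inE /=.
  move=> /andP[/andP[par2 _] B2Q2] /andP[/andP[par1 _] B1Q1].
  have eqB : B1 = B2.
    rewrite -(setU1K (xB _ _ par1 B1Q1)) -(blk _ _ p1) eq_ins blk //.
    by rewrite setU1K // (xB _ _ par2).
  congr (_, _) => //; rewrite -(setD1K B1Q1) -(setD1K B2Q2).
  rewrite -(setU1K (newB _ _ p1)) -(setU1K (newB _ _ p2)).
  by rewrite -[_ |: Q1 :\ B1]/(ins (Q1, B1)) eq_ins eqB.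
apply: eq_card => P; rewrite !inE; apply/andP/imsetP.
  move=> [xP /andP[parP /eqP cP]].
  have xcov : x \in cover P by rewrite (cover_partition parP) setU11.
  (* The block of x in P is C, and C :\ x is a block of the partition of D. *)
  pose C := pblock P x; have CP : C \in P by exact: pblock_mem.
  have xC : x \in C by rewrite mem_pblock.
  have B0 : C :\ x != set0.
    apply: contra xP => /eqP C0; rewrite -(setD1K xC) C0 setU0 in CP.
    by [].
  have parPC := partitionD1 parP CP.
  have BPC : C :\ x \notin P :\ C.
    apply/negP => /(partitionS parPC)/subsetP sB.
    have [y yB] := set0Pn _ B0; have := sB _ yB; rewrite !inE in yB *.
    by case/andP: yB => _ ->.
  exists ((C :\ x) |: (P :\ C), C :\ x); last first.
    by rewrite /ins /= setU1K // !setD1K.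
  rewrite !inE /= eqxx andbT cardsU1 BPC -cP [#|P|](cardsD1 C) CP eqxx andbT.
  have -> : D = (C :\ x) :|: ((x |: D) :\: C).
    apply/setP => y; rewrite !inE; have [-> | yx] /= := eqVneq y x.
      by rewrite xC (negPf xD).
    have := subsetP (partitionS parP CP) y; rewrite !inE (negPf yx) /=.
    by case: (y \in C) => // ->.
  apply: partitionU1 => //; rewrite -setI_eq0; apply/eqP/setP => y.
  by rewrite !inE; case: (y \in C); rewrite ?andbF.
case=> -[Q B] p ->; have := p; rewrite !inE /= => /andP[/andP[parQ /eqP cQ] BQ].
rewrite insP // cardsU1 newB // -cQ [#|Q|](cardsD1 B) BQ eqxx; split=> //.
rewrite /= negb_or negb_and; apply/andP; split.
  have /set0Pn[y yB] := partition_neq0 parQ BQ.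
  apply/eqP => /setP/(_ y); rewrite !inE yB orbT => /eqP yx.
  by have := xB _ _ parQ BQ; rewrite -yx yB.
by apply/orP; right; apply/negP => /(xB _ _ parQ); rewrite set11.
Qed.

Lemma card_set_partitions_setU1 r :
  #|set_partitions (x |: D) r.+1| =
  r.+1 * #|set_partitions D r.+1| + #|set_partitions D r|.
Proof.
rewrite -(cardsID [set P : {set {set T}} | [set x] \in P]).
by rewrite card_set_partitions_singleton card_set_partitions_insert addnC.
Qed.

End Recurrence.

Lemma card_set_partitions0 (T : finType) (D : {set T}) :
  #|set_partitions D 0| = (D == set0).
Proof.
have -> : set_partitions D 0 = if D == set0 then [set set0] else set0.
  apply/setP => P; rewrite inE cards_eq0 andbC.
  have [-> /= | P0] := eqVneq P set0; last by case: ifP; rewrite inE // (negPf P0).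
  rewrite /partition /cover /trivIset /cover !big_set0 cards0 eqxx inE andbT [set0 == D]eq_sym.
  by case: eqP => _; rewrite inE ?eqxx.
by case: eqP; rewrite ?cards1 ?cards0.
Qed.

Lemma card_set_partitions_set0 (T : finType) r :
  #|set_partitions (set0 : {set T}) r.+1| = 0.
Proof.
apply: eq_card0 => P; rewrite inE partition_set0.
by case: eqP => // ->; rewrite cards0.
Qed.

(** The recurrence determines the number of partitions from the cardinal of the
    ground set.  This transports [card_set_partitions_setU1] from a subset of
    ['I_k.+1] to ['I_k]. *)
Lemma card_set_partitions_eq (T U : finType) (D : {set T}) (E : {set U}) r :
  #|D| = #|E| -> #|set_partitions D r| = #|set_partitions E r|.
Proof.
move: {1}#|D| (erefl #|D|) => m; elim: m D E r => [|m IHm] D E r cD cE.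
  rewrite -cD in cE; move/esym/cards0_eq: cD => ->.
  move/esym/cards0_eq: cE => ->; case: r => [|r]; first by rewrite !card_set_partitions0 !eqxx.
  by rewrite !card_set_partitions_set0.
have [x xD] : exists x, x \in D by apply/card_gt0P; rewrite -cD.
have [y yE] : exists y, y \in E by apply/card_gt0P; rewrite -cE -cD.
have cDx : m = #|D :\ x| by rewrite (cardsD1 x) xD add1n in cD; case: cD.
have cEy : #|D :\ x| = #|E :\ y|.
  by move: cE; rewrite (cardsD1 x D) (cardsD1 y E) xD yE => -[].
rewrite -(setD1K xD) -(setD1K yE); case: r => [|r].
  rewrite !card_set_partitions0 -!cards_eq0 !cardsU1 -cEy; congr (nat_of_bool (_ == _)).
  by rewrite !inE !eqxx.
by rewrite !card_set_partitions_setU1 ?setD11 // !(IHm _ _ _ cDx cEy).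
Qed.

Lemma stirling2S k r :
  stirling2 k.+1 r.+1 = r.+1 * stirling2 k r.+1 + stirling2 k r.
Proof.
rewrite -[stirling2 _ _]/(#|set_partitions [set: 'I_k.+1] r.+1|) -(setD1K (in_setT ord0)).
rewrite card_set_partitions_setU1 ?setD11 //.
have cT : #|[set: 'I_k.+1] :\ ord0| = #|[set: 'I_k]|.
  by rewrite setTD cardsC1 cardsT !card_ord.
by rewrite !(card_set_partitions_eq _ cT).
Qed.

Lemma stirling2_0 k : stirling2 k 0 = (k == 0).
Proof.
rewrite -[LHS]/#|set_partitions _ _| card_set_partitions0 -cards_eq0.
by rewrite cardsT card_ord.
Qed.

Lemma stirling2_small k r : k < r -> stirling2 k r = 0.
Proof.
elim: k r => [|k IHk] [|r] // kr; last by rewrite stirling2S !IHk ?muln0 // ltnW.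
have E0 : [set: 'I_0] = set0 by apply/setP => -[].
by rewrite -[stirling2 _ _]/#|set_partitions _ _| E0 card_set_partitions_set0.
Qed.

(** The number of histories of length [k], with a given first vertex, that lead to
    a given cut word with [r] gaps. *)
Definition weight k r := 2 ^ (k - r) * (r - 1)`! * stirling2 k r.

Lemma weightS k r : 0 < k ->
  weight k.+1 r.+1 = (2 * r.+1) * weight k r.+1 + r * weight k r.
Proof.
move=> k_gt0; rewrite /weight stirling2S !subSS subn0 !subn1 /=.
have [kr | rk] := leqP k r.
  rewrite (stirling2_small (r := r.+1)) // !muln0 !add0n.
  move: kr; rewrite leq_eqVlt => /orP[/eqP kr | kr]; last first.
    by rewrite stirling2_small // !muln0.
  by subst k; rewrite subnn; case: r k_gt0 => // r _; rewrite factS /=; ring.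
rewrite -(subnSK rk) expnS; case: r rk => [|r] rk.
  by rewrite stirling2_0 (gtn_eqF k_gt0) mul0n !addn0; ring.
by rewrite factS /=; ring.
Qed.

(** * Removal histories on the cycle *)

Section Cycle.

Variable p : nat.
Local Notation n := p.+2.
Implicit Types (a x v : 'Z_n) (s : seq 'Z_n).

(** A list of removed vertices has the latest one at its head, so that its last
    entry is the origin.  The word starts just after the origin. *)
Definition removed_word s : seq bool :=
  mkseq (fun j => last 0%R s + j.+1%:R \in s)%R p.+1.

Definition cut_code s := cuts true (removed_word s).

(** The condition is imposed on all nonempty suffixes, that is at all times of the
    history; the full cycle at time 0 never has an isolated vertex. *)
Fixpoint admissible s : bool :=
  if s is x :: s' then
    [&& x \notin s', admissible s' & ~~ has_isolated (~: [set y in s])]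
  else true.

Lemma natZ_inj i j : i < n -> j < n -> (i%:R = j%:R :> 'Z_n)%R -> i = j.
Proof.
move=> ltin ltjn /(congr1 val); rewrite /= !val_Zp_nat //.
by rewrite !modn_small.
Qed.

Lemma natZ_n : (n%:R = 0 :> 'Z_n)%R.
Proof. by exact: pchar_Zp. Qed.

Lemma perm_turn a :
  perm_eq (enum 'Z_n) (a :: [seq (a + i.+1%:R)%R | i <- iota 0 p.+1]).
Proof.
have -> : a :: [seq (a + i.+1%:R)%R | i <- iota 0 p.+1] =
    [seq (a + i%:R)%R | i <- iota 0 n].
  by rewrite -[RHS]/(mkseq (fun i => a + i%:R)%R n) mkseq_head addr0.
rewrite uniq_perm ?enum_uniq //.
  rewrite map_inj_in_uniq ?iota_uniq // => i j; rewrite !mem_iota !add0n => li lj.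
  by move/addrI/natZ_inj; apply.
move=> x; rewrite mem_enum; symmetry; apply/mapP; exists (val (x - a)%R).
  by rewrite mem_iota ltn_ord.
by rewrite natr_Zp addrC subrK.
Qed.

Lemma card_turn a (P : pred 'Z_n) :
  #|[pred x | (x != a) && P x]| =
  count (fun i => P (a + i.+1%:R)%R) (iota 0 p.+1).
Proof.
rewrite cardE /enum_mem size_filter -enumT (seq.permP (perm_turn a)).
rewrite -cat1s count_cat count_map [X in X + _]/= inE eqxx add0n.
apply: eq_in_count => i.
rewrite mem_iota add0n => li; rewrite /= inE -subr_eq0 addrAC subrr add0r.
suff -> : (i.+1%:R != 0 :> 'Z_n)%R by [].
by apply/eqP => /(@natZ_inj i.+1 0 li isT).
Qed.

Lemma turnP a x : x != a -> exists2 i, i < p.+1 & x = (a + i.+1%:R)%R.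
Proof.
move=> xa; have : x \in a :: [seq (a + i.+1%:R)%R | i <- iota 0 p.+1].
  by rewrite -(perm_mem (perm_turn a)) mem_enum.
rewrite in_cons (negPf xa) => /mapP[i]; rewrite mem_iota => li ->.
by exists i.
Qed.

Lemma isolatedE (A : {set 'Z_n}) v :
  isolated A v = [&& v \in A, (v - 1)%R \notin A & (v + 1)%R \notin A].
Proof.
rewrite /isolated; congr (_ && _); apply/forallP/andP => [allA | [A1 A2] w].
  by split; [have := allA (v - 1)%R | have := allA (v + 1)%R];
     rewrite /cycle_adj eqxx ?orbT.
by apply/implyP; rewrite /cycle_adj => /orP[] /eqP ->.
Qed.

(** Position [i] of [true :: removed_word s] is the vertex at distance [i] from
    the origin, and the default value [true] of [nth] is right at distance [n],
    where the origin comes back. *)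
Lemma has_isolated_cut_code s : s != [::] ->
  has_isolated (~: [set y in s]) = ~~ sorted not_both (cut_code s).
Proof.
move=> s_n0; rewrite /cut_code sorted_cuts negbK size_mkseq.
set a := last 0%R s; have as_ : a \in s.
  by rewrite /a; case: (s) s_n0 => // y t _; exact: (mem_last y t).
have nthw j : j <= p.+1 -> nth true (removed_word s) j = (a + j.+1%:R \in s)%R.
  rewrite leq_eqVlt => /orP[/eqP -> | lj]; last by rewrite nth_mkseq.
  by rewrite nth_default ?size_mkseq // natZ_n addr0 as_.
have nthtw j : j <= p.+1 -> nth true (true :: removed_word s) j = (a + j%:R \in s)%R.
  by case: j => [|j] lj /=; [rewrite addr0 as_ | rewrite nthw // ltnW].
apply/existsP/hasP => [[v] | [i]].
  rewrite isolatedE !inE negbK => /and3P[vs v1 v2].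
  have va : v != a by apply: contraNneq vs => ->.
  have [i li Ev] := turnP va; exists i; first by rewrite mem_iota.
  rewrite nthtw ?nthw // ?(ltnW li) // -Ev vs /=.
  rewrite -natr1 addrA -Ev; move: v1 v2.
  by rewrite {1}Ev -natr1 addrA addrK negbK => -> ->.
rewrite mem_iota add0n => li /and3P[].
rewrite nthtw ?(ltnW li) // !nthw ?(ltnW li) // => v1 vs v2.
exists (a + i.+1%:R)%R; rewrite isolatedE !inE vs !negbK /=.
rewrite [X in _ && (X \in s)](_ : _ = a + i.+2%:R)%R; last first.
  by rewrite -addrA natr1.
rewrite v2 andbT.
by rewrite -natr1 addrA addrK v1.
Qed.

Lemma admissible_cons x s :
  admissible (x :: s) =
  [&& x \notin s, admissible s & ~~ has_isolated (~: [set y in x :: s])].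
Proof. by []. Qed.

Lemma admissible_uniq s : admissible s -> uniq s.
Proof. by elim: s => //= x s IHs /and3P[-> /IHs]. Qed.

Lemma admissible_sorted s : admissible s -> s != [::] -> sorted not_both (cut_code s).
Proof.
by case: s => // x s /and3P[_ _]; rewrite has_isolated_cut_code // negbK.
Qed.

Lemma size_cut_code s : uniq s -> s != [::] -> size (cut_code s) = (n - size s).+1.
Proof.
move=> Us s_n0; rewrite /cut_code size_cuts; congr _.+1.
rewrite /removed_word /mkseq count_map.
rewrite -(card_turn (last 0%R s) (fun x => x \notin s)).
have -> : n - size s = #|'Z_n| - #|s| by rewrite card_ord (card_uniqP Us).
rewrite -(cardC (mem s)) addKn; apply: eq_card => x; rewrite !inE.
apply: andb_idl; apply: contraNneq => ->.
by case: (s) s_n0 => // y t _; exact: (mem_last y t).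
Qed.

Lemma cut_code_cons s i : s != [::] -> i < p.+1 ->
  cut_code ((last 0 s + i.+1%:R)%R :: s) =
  cuts true (mkseq (fun j => (j == i) || (last 0 s + j.+1%:R \in s)%R) p.+1).
Proof.
move=> s_n0 li; rewrite /cut_code /removed_word.
have -> : last 0%R ((last 0 s + i.+1%:R)%R :: s) = last 0%R s by case: (s) s_n0.
congr (cuts _ _); apply/eq_in_map => j; rewrite mem_iota add0n => lj.
rewrite inE (inj_eq (addrI _)); congr (_ || _).
by apply/eqP/eqP => [/(@natZ_inj j.+1 i.+1 lj li) [] | ->].
Qed.

Definition histories m (e : seq bool) :=
  #|[pred s : m.-tuple 'Z_n | admissible s && (cut_code s == e)]|.

(** The next removals from [s] correspond to the letters [false] of
    [removed_word s], and [count_merges_splits] turns the count of successors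
    of the state of [s] equal to [e] into a count of predecessors of [e]. *)
Lemma card_admissible_cons s e :
  s != [::] -> admissible s -> sorted not_both e ->
  #|[pred x | admissible (x :: s) && (cut_code (x :: s) == e)]| =
  count_mem (cut_code s) (splits e).
Proof.
move=> s_n0 adm_s sort_e.
rewrite -count_merges_splits -[merges _]/(merges (cuts true (removed_word s))).
rewrite -map_cuts_removals removals_mkseq -map_comp.
rewrite count_map count_filter.
transitivity #|[pred x | (x != last 0%R s) &&
                         ((x \notin s) && (cut_code (x :: s) == e))]|.
  apply: eq_card => x; rewrite !inE admissible_cons adm_s andTb.
  have -> : (x != last 0%R s) && ((x \notin s) && (cut_code (x :: s) == e)) =
            ((x \notin s) && (cut_code (x :: s) == e)).
    apply: andb_idl => /andP[xs _]; apply: contraNneq xs => ->.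
    by case: (s) s_n0 => // y t _; exact: (mem_last y t).
  rewrite has_isolated_cut_code // negbK -andbA; congr (_ && _).
  by apply: andb_idl => /eqP ->.
rewrite card_turn; apply: eq_in_count => i; rewrite mem_iota add0n => li.
by rewrite [in RHS]/= andbC cut_code_cons.
Qed.

(** Undoing the last removal.  Admissibility of the last state is a property of
    [e] alone, hence the hypothesis. *)
Lemma historiesS m e : 0 < m -> sorted not_both e ->
  histories m.+1 e = \sum_(e' <- splits e) histories m e'.
Proof.
move=> m_gt0 sort_e; rewrite /histories.
rewrite (@card_cons_tuple _ m (fun s => admissible s && (cut_code s == e))).
transitivity (\sum_(s : m.-tuple 'Z_n) \sum_(e' <- splits e)
    (admissible s && (cut_code s == e') : nat)).
  apply: eq_bigr => s _.
  have s_n0 : tval s != [::] by rewrite -size_eq0 size_tuple -lt0n.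
  case: (boolP (admissible s)) => [adm_s | /negPf not_adm] /=; last first.
    by rewrite big1 // eq_card0 // => x; rewrite inE /= not_adm !andbF.
  rewrite card_admissible_cons // -sum1_count big_mkcond; apply: eq_bigr => e' _ /=.
  by rewrite eq_sym; case: eqP.
rewrite exchange_big /=; apply: eq_bigr => e' _.
by rewrite -sum1_card [RHS]big_mkcond; apply: eq_bigr => s _ /=; rewrite inE; case: ifP.
Qed.

Lemma histories_improper m e : 0 < m -> ~~ proper e -> histories m e = 0.
Proof.
move=> m_gt0; apply: contraNeq; rewrite -lt0n => /card_gt0P[s].
rewrite inE => /andP[adm_s /eqP <-].
have s_n0 : tval s != [::] by rewrite -size_eq0 size_tuple -lt0n.
move: (admissible_sorted adm_s s_n0) (last_cuts true true (removed_word s)).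
by rewrite /cut_code cuts_cons; move: (behead _) => f /= sort_f last_f; apply/andP.
Qed.

(* With n = 2 the survivor of the first removal would be isolated. *)
Hypothesis p_gt0 : 0 < p.

Lemma cut_code1 x : cut_code [:: x] = true :: rcons (nseq p false) true.
Proof.
rewrite /cut_code; have -> : removed_word [:: x] = nseq p.+1 false.
  rewrite /removed_word -[RHS]cats0 -(mkseq_nth true (nseq _ _ ++ _)) cats0 size_nseq.
  apply/eq_in_map => j; rewrite mem_iota add0n => /andP[_ lj].
  rewrite nth_nseq lj inE /= -subr_eq0 addrAC subrr add0r.
  by apply/eqP => /(@natZ_inj j.+1 0 lj isT).
by rewrite /=; congr (_ :: _); elim: (p) => //= q ->.
Qed.

Lemma spaced_nseq b q : ~~ b || (0 < q) -> spaced b (rcons (nseq q false) true).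
Proof.
rewrite /spaced last_rcons andbT; elim: q b => [|q IHq] b /=.
  by rewrite orbF /not_both andbT andbT.
by rewrite /not_both andbF => _; apply: IHq.
Qed.

Lemma admissible1 x : admissible [:: x].
Proof.
rewrite /= has_isolated_cut_code // negbK cut_code1 /=.
by have /andP[] := @spaced_nseq true p p_gt0.
Qed.

(** After one removal there is a single state, with one gap, and [weight 1 r]
    vanishes unless [r] is 1. *)
Lemma histories1 f : size f = p.+1 -> spaced true f ->
  histories 1 (true :: f) = n * weight 1 (count id f).
Proof.
move=> sz_f ok_f.
have [Ef | fN] := eqVneq f (rcons (nseq p false) true).
  rewrite /histories Ef -cats1 count_cat count_nseq /= mul0n.
  have -> : weight 1 (0 + (true + 0)) = 1.
    by rewrite /weight (stirling2S 0 0) stirling2_0 (stirling2_small (r := 1)).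
  rewrite muln1; transitivity #|{: 1.-tuple 'Z_n}|; last first.
    by rewrite card_tuple expn1 card_ord.
  apply: eq_card => s; rewrite !inE; case/tupleP: s => x s; rewrite [s]tuple0.
  by rewrite -[tval _]/[:: x] admissible1 cut_code1 -cats1 eqxx.
transitivity 0.
  apply: eq_card0 => s; rewrite inE; case/tupleP: s => x s; rewrite [s]tuple0.
  by rewrite -[tval _]/[:: x] cut_code1 eqseq_cons [_ == f]eq_sym (negPf fN) !andbF.
have c1 : 1 < count id f.
  case/andP: ok_f => _; case/lastP: f sz_f fN => // f y; rewrite last_rcons => sz_f fN.
  move=> yT; rewrite {}yT in sz_f fN *; rewrite -cats1 count_cat /= addn1 ltnS lt0n.
  apply: contra fN => /eqP c0; rewrite eqseq_rcons eqxx andbT.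
  move: sz_f; rewrite size_rcons => -[<-]; apply/eqP/all_pred1P.
  rewrite -[all _ _]negbK -has_predC has_count -leqNgt -c0 sub_count //.
  by case.
by rewrite /weight stirling2_small ?muln0.
Qed.

(** By induction on the last removal: [sum_splits_proper] counts the predecessors
    by their number of gaps, and the sum is the recurrence of [weight]. *)
Lemma histories_proper m f :
  0 < m -> size f + m = n -> f != [::] -> spaced true f ->
  histories m (true :: f) = n * weight m (count id f).
Proof.
case: m => // m _; elim: m f => [|m IHm] f sz_f f_n0 ok_f.
  by apply: histories1 => //; move: sz_f; rewrite addn1 => -[].
rewrite historiesS //; last by case/andP: ok_f.
transitivity (\sum_(e <- splits (true :: f) | proper e)
    n * weight m.+1 (count id (behead e))).
  rewrite [RHS]big_mkcond; apply: eq_big_seq => e /size_splits sz_e.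
  case: (boolP (proper e)) => [|bad_e]; last by rewrite histories_improper.
  case: e sz_e => [|[] g] //= [sz_g] ok_g; apply: IHm => //.
    by rewrite sz_g addSn -addnS.
  by rewrite -size_eq0 sz_g.
rewrite -big_distrr /= sum_splits_proper //; congr (_ * _).
have := spaced_count_gt0 f_n0 ok_f; case: (count id f) => // r _.
by rewrite [RHS]weightS.
Qed.

(** Every admissible list has a cut word of length [n - k + 1] with initial letter
    [true]; sum over the rest of the word. *)
Lemma card_admissible k : 0 < k <= p.+1 ->
  #|[pred s : k.-tuple 'Z_n | admissible s]| =
  n * \sum_(f : (n - k).-tuple bool | spaced true f) weight k (count id f).
Proof.
case/andP=> k_gt0 k_lt.
transitivity (\sum_(f : (n - k).-tuple bool) histories k (true :: f)).
  transitivity (\sum_(f : (n - k).-tuple bool)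
    \sum_(s : k.-tuple 'Z_n | admissible s) (cut_code s == true :: f : nat)).
    rewrite exchange_big -sum1_card; apply: eq_bigr => s; rewrite inE => adm_s.
    have s_n0 : tval s != [::] by rewrite -size_eq0 size_tuple -lt0n.
    have sz : size (behead (cut_code s)) == n - k.
      by rewrite size_behead size_cut_code ?admissible_uniq // size_tuple.
    rewrite (bigD1 (Tuple sz)) //= big1 ?addn0 => [|f fN].
      by have -> : cut_code s = true :: behead (cut_code s); rewrite /cut_code cuts_cons ?eqxx.
    apply/eqP; rewrite eqb0; apply: contra fN => /eqP Es.
    by apply/eqP/val_inj; rewrite /= Es.
  apply: eq_bigr => f _; rewrite /histories -sum1_card [RHS]big_mkcond [LHS]big_mkcond.
  by apply: eq_bigr => s _; rewrite inE; case: (admissible s) => //=; case: eqP.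
rewrite big_distrr [RHS]big_mkcond; apply: eq_bigr => f _ /=.
case: ifPn => ok_f; last by rewrite histories_improper.
have sz_f : size f + k = n by rewrite size_tuple subnK // ltnW.
apply: histories_proper => //.
by rewrite -size_eq0 size_tuple subn_eq0 -ltnNge.
Qed.

Lemma admissible_all s : uniq s ->
  admissible s =
  all (fun i => ~~ has_isolated (~: [set y in drop i s])) (iota 0 (size s)).
Proof.
elim: s => // x s IHs /andP[xs /IHs adm_s].
rewrite admissible_cons xs adm_s andTb andbC.
have -> : iota 0 (size (x :: s)) = 0 :: [seq i.+1 | i <- iota 0 (size s)].
  by rewrite -(iotaDl 1 0).
by rewrite /= all_map.
Qed.

Definition listing (pi : {perm 'Z_n}) : n.-tuple 'Z_n := [tuple pi i | i < n].

Lemma listing_uniq pi : uniq (listing pi).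
Proof. by rewrite map_inj_uniq ?enum_uniq //; apply: perm_inj. Qed.

Lemma prefix_setE pi t : prefix_set pi t = ~: [set y in drop t (listing pi)].
Proof.
apply/setP => y; rewrite !inE /= -map_drop -[y](permKV pi).
set i := (_ y); rewrite (mem_map (@perm_inj _ pi)).
rewrite mem_imset; last exact: perm_inj.
rewrite inE -(mem_map val_inj) map_drop val_enum_ord drop_iota mem_iota add0n.
have := ltn_ord i; rewrite -[Zp_trunc n]/p /=; lia.
Qed.

Lemma has_isolatedT : has_isolated [set: 'Z_n] = false.
Proof. by apply/existsP => -[v]; rewrite isolatedE !inE. Qed.

(** The sets of survivors at times [n - k] to [n - 1] are the complements of the
    nonempty suffixes of the last [k] vertices of the listing. *)
Lemma ltn_K pi k : k <= p.+1 -> (k < K pi) = admissible (drop (n - k) (listing pi)).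
Proof.
move=> kp; rewrite admissible_all ?drop_uniq ?listing_uniq //.
rewrite size_drop size_tuple subKn; last exact: ltnW.
transitivity (tau pi <= n - k.+1); first by rewrite /K; lia.
apply/bigmax_leqP/allP => [tau_le i | no_iso t iso_t].
  rewrite mem_iota add0n => /= ik; rewrite drop_drop -prefix_setE.
  have lt_t : i + (n - k) < n.+1 by lia.
  by apply/negP => /(tau_le (Ordinal lt_t)) /=; lia.
rewrite leqNgt; apply/negP => lt_t.
(* At time n the full cycle survives, which has no isolated vertex. *)
have t_le := ltn_ord t; have [t_n | t_n] := eqVneq (t : nat) n.
  move: iso_t; rewrite prefix_setE t_n drop_oversize ?size_tuple //.
  by rewrite (_ : ~: _ = setT) ?has_isolatedT //; apply/setP => y; rewrite !inE.
have t_in : t - (n - k) \in iota 0 k by rewrite mem_iota; lia.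
have := no_iso _ t_in; rewrite drop_drop subnK; last by lia.
by rewrite -prefix_setE iso_t.
Qed.

(** Permutations are the duplicate-free [n]-tuples, and the event only concerns
    their last [k] entries. *)
Lemma card_ltn_K k : 0 < k <= p.+1 ->
  #|[pred pi : {perm 'Z_n} | k < K pi]| =
  (n - k)`! * n *
  \sum_(1 <= r < ((n - k) %/ 2).+1) weight k r * 'C(n - k - r - 1, r - 1).
Proof.
move=> k_bnd; have [k_gt0 k_le] := andP k_bnd.
rewrite -sum_spaced_true ?subn_gt0 // -mulnA -card_admissible //.
transitivity #|[pred u : n.-tuple 'Z_n | uniq u && admissible (drop (n - k) u)]|.
  have inj_listing : injective listing.
    move=> pi rho eq_l; apply/permP => i.
    by have := congr1 (fun u : n.-tuple _ => tnth u i) eq_l; rewrite !tnth_mktuple.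
  rewrite -(card_image inj_listing); apply: eq_card => u; rewrite inE.
  apply/imageP/andP => [[pi] | [Uu adm_u]].
    by rewrite inE => lt_k ->; rewrite listing_uniq -ltn_K.
  have inj_u : injective (tnth u) by apply/tuple_uniqP.
  have Eu : listing (perm inj_u) = u.
    by apply: eq_from_tnth => i; rewrite tnth_mktuple permE.
  by exists (perm inj_u); rewrite ?Eu // inE ltn_K // Eu.
have En : n = (n - k) + k by lia.
rewrite (card_uniq_drop _ En) card_ord ffactnn; congr (_ * _).
by apply: eq_card => s; rewrite !inE; apply: andb_idl; exact: admissible_uniq.
Qed.

End Cycle.

(** * The law of K *)

Local Open Scope ring_scope.

Theorem theorem3p3 (n k : nat) (hn : (3 <= n)%N) (hk : (1 <= k <= n - 1)%N) :
  Pr [pred pi : {perm 'Z_n} | (k < K pi)%N] =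
    ((n - k)`!)%:R / ((n - 1)`!)%:R *
      \sum_(1 <= r < (minn k ((n - k) %/ 2)).+1)
        (2 ^ (k - r) * (r - 1)`! * stirling2 k r * 'C(n - k - r - 1, r - 1))%:R
  /\
  Pr [pred pi : {perm 'Z_n} | K pi == k] =
    Pr [pred pi : {perm 'Z_n} | (k - 1 < K pi)%N]
      - Pr [pred pi : {perm 'Z_n} | (k < K pi)%N].
Proof.
split; last first.
  rewrite /Pr -mulrBl; congr (_ / _); apply/eqP; rewrite eq_sym subr_eq -natrD.
  apply/eqP; congr _%:R; rewrite -(cardID [pred pi : {perm 'Z_n} | K pi == k]).
  congr (_ + _)%N; apply: eq_card => pi; rewrite !inE; lia.
case: n hn hk => [|[|p]] // p_gt0 hk.
have k_bnd : (0 < k <= p.+1)%N by move: hk; rewrite subn1.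
rewrite /Pr (card_ltn_K _ k_bnd) //.
have -> : #|{perm 'Z_p.+2}| = (p.+2)`!%N by rewrite -[RHS]card_Sn.
rewrite -natr_sum factS -[(p.+2 - 1)%N]/p.+1.
have -> : (\sum_(1 <= r < (minn k ((p.+2 - k) %/ 2)).+1)
    2 ^ (k - r) * (r - 1)`! * stirling2 k r * 'C(p.+2 - k - r - 1, r - 1) =
  \sum_(1 <= r < ((p.+2 - k) %/ 2).+1) weight k r * 'C(p.+2 - k - r - 1, r - 1))%N.
  (* The terms with r > k vanish since S(k, r) = 0. *)
  rewrite [RHS](@big_cat_nat _ _ _ (minn k ((p.+2 - k) %/ 2)).+1) ?ltnS ?geq_minr //=.
  rewrite [X in _ = (_ + X)%N]big_nat [X in _ = (_ + X)%N]big1 ?addn0 // => r r_bnd.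
  by rewrite /weight stirling2_small ?muln0 //; lia.
move: (p.+1)`!%N (fact_gt0 p.+1) => F; rewrite lt0n => F_n0; rewrite !natrM.
by field; rewrite !pnatr_eq0 F_n0 -natrD pnatr_eq0.
Qed.
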